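(* For every integer $s$ there exist positive integers $a_0, n_0$ (depending only on $s$) such that for all integers $a\ge a_0$ and $n\ge n_0$, the Cartesian product $G := S_a \square H_n$ has stack number $\mathrm{sn}(G)\ge s$.
   Context: $S_a$ denotes the star with $a$ leaves (one root vertex adjacent to $a$ leaves). $H_n$ denotes the graph with vertex set $V(H_n)=\{1,\ldots,n\}^2$ in which $u=[a',b']$ and $v=[c',d']$ are adjacent if and only if $|a'-c'|+|b'-d'|=1$ or $a'-c'=b'-d'\in\{-1,1\}$. $G_1\square G_2$ is the Cartesian product of graphs: its vertex set is $V(G_1)\times V(G_2)$, and $(u,p),(v,q)$ are adjacent iff ($u=v$ and $pq\in E(G_2)$) or ($p=q$ and $uv\in E(G_1)$). Given a graph $G$ and a strict linear order $\prec$ on $V(G)$, two edges $xx',yy'\in E(G)$ with $x\prec x'$ and $y\prec y'$ are said to $\prec$-cross if $x\prec y\prec x'\prec y'$ or $y\prec x\prec y'\prec x'$. The stack number $\mathrm{sn}(G)$ is the minimum integer $k$ such that there exist a strict linear order $\prec$ of $V(G)$ and a colouring of the edges of $G$ by $k$ colours such that no two edges of the same colour $\prec$-cross. *)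

(* Defs.v *)
From HB Require Import structures.
From mathcomp Require Import all_boot all_order all_algebra.
From mathcomp Require Import boolp.

Set Implicit Arguments.
Unset Strict Implicit.
Unset Printing Implicit Defensive.

Import GRing.Theory Num.Theory.

Record sgraph := SGraph {
  vertex :> finType;
  adj : rel vertex;
  adj_sym : symmetric adj;
  adj_irrefl : irreflexive adj }.

Definition edges (G : sgraph) : {set {set G}} :=
  [set [set xy.1; xy.2] | xy in [set xy : G * G | adj xy.1 xy.2]].

(* Edges form a type of their own so that an edgeless graph has a colouring by
   'I_0, hence stack number 0. *)
Definition edge (G : sgraph) : finType := {e : {set G} | e \in edges G}.

Definition strict_linear_order (T : eqType) (lt : rel T) : Prop :=
  [/\ irreflexive lt, transitive lt & forall x y, x != y -> lt x y || lt y x].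

Definition edges_cross (G : sgraph) (lt : rel G) (e f : edge G) : Prop :=
  exists x x' y y' : G,
    [/\ val e = [set x; x'], val f = [set y; y'], lt x x', lt y y' &
        [&& lt x y, lt y x' & lt x' y'] || [&& lt y x, lt x y' & lt y' x']].

Definition has_stack_layout (G : sgraph) (k : nat) : Prop :=
  exists (lt : rel G) (colour : edge G -> 'I_k),
    strict_linear_order lt /\
    forall e f : edge G, colour e = colour f -> ~ edges_cross lt e f.

Lemma has_stack_layout_ex (G : sgraph) :
  exists k : nat, `[< has_stack_layout G k >].
Proof.
exists #|edge G|; apply/asboolP.
exists (fun x y => enum_rank x < enum_rank y), enum_rank; split; first split.
- by move=> x; rewrite ltnn.
- by move=> y x z; apply: ltn_trans.
- by move=> x y; rewrite -neq_ltn; apply: contraNneq => /ord_inj/enum_rank_inj->.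
move=> e f /enum_rank_inj <- [x [x' [y [y' [-> eqxy ltx lty crossxy]]]]].
have : x \in [set y; y'] by rewrite -eqxy set21.
have : x' \in [set y; y'] by rewrite -eqxy set22.
rewrite !inE => /orP[]/eqP Ex' /orP[]/eqP Ex; subst.
all: by move: ltx lty crossxy; rewrite ?ltnn ?andbF //= => ltx;
  rewrite ?(ltnNge (enum_rank y')) ?(ltnW ltx).
Qed.

Definition stack_number (G : sgraph) : nat := ex_minn (has_stack_layout_ex G).

Section Star.

Variable a : nat.

(* [None] is the root and the [Some i] are the leaves. *)
Definition star_adj : rel (option 'I_a) := fun u v => isSome u != isSome v.

Lemma star_adj_sym : symmetric star_adj.
Proof. by move=> u v; rewrite /star_adj eq_sym. Qed.

Lemma star_adj_irrefl : irreflexive star_adj.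
Proof. by move=> u; rewrite /star_adj eqxx. Qed.

Definition star : sgraph := SGraph star_adj_sym star_adj_irrefl.

End Star.

Section TriangulatedGrid.

Variable n : nat.

Local Open Scope ring_scope.

(* Coordinates range over 0, ..., n - 1 instead of 1, ..., n; adjacency only
   involves their differences, taken in [int]. *)
Definition tgrid_adj : rel ('I_n * 'I_n) := fun u v =>
  let da := (val u.1)%:Z - (val v.1)%:Z in
  let db := (val u.2)%:Z - (val v.2)%:Z in
  (`|da| + `|db| == 1) || ((da == db) && (da \in [:: -1; 1])).

Lemma tgrid_adj_sym : symmetric tgrid_adj.
Proof.
move=> u v; rewrite /tgrid_adj.
have opp_eqN1 (x : int) : (- x \in [:: -1; 1]) = (x \in [:: -1; 1]).
  by rewrite !inE eqr_opp eqr_oppLR orbC.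
rewrite -(opprB (val v.1)%:Z) -(opprB (val v.2)%:Z).
by rewrite !normrN eqr_opp opp_eqN1.
Qed.

Lemma tgrid_adj_irrefl : irreflexive tgrid_adj.
Proof. by move=> u; rewrite /tgrid_adj !subrr. Qed.

Definition tgrid : sgraph := SGraph tgrid_adj_sym tgrid_adj_irrefl.

End TriangulatedGrid.

Section CartesianProduct.

Variables G1 G2 : sgraph.

Definition cart_adj : rel (G1 * G2) := fun u v =>
  (u.1 == v.1) && adj u.2 v.2 || (u.2 == v.2) && adj u.1 v.1.

Lemma cart_adj_sym : symmetric cart_adj.
Proof.
move=> u v; rewrite /cart_adj (eq_sym u.1) (eq_sym u.2).
by rewrite (adj_sym u.1) (adj_sym u.2).
Qed.

Lemma cart_adj_irrefl : irreflexive cart_adj.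
Proof. by move=> u; rewrite /cart_adj !adj_irrefl !andbF. Qed.

Definition cart_prod : sgraph := SGraph cart_adj_sym cart_adj_irrefl.

End CartesianProduct.

(* Main.v *)
Require Import Defs.
From mathcomp Require Import all_boot all_order all_algebra.
From mathcomp Require Import zify.

Set Implicit Arguments.
Unset Strict Implicit.
Unset Printing Implicit Defensive.

(** Fix the number [k] of stacks.  A layout of the product of a star with a
    graph [H] puts one copy of [H] at every leaf.  When the star has many
    leaves, Ramsey's theorem ([ramsey]) finds leaves u0, u1, ... such that the
    relative order of any two of their copies, and the colours in and at these
    copies, follow one pattern.  In particular the copies of a vertex [p] of [H]
    form a sequence p0, p1, ... that is either increasing or decreasing; this
    2-colours [H].

    Let [p] and [q] be adjacent and both increasing.  If all copies of [p]
    preceded all copies of [q], then the edges p0 q0 and p1 q1 would cross,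
    and they have the same colour.  So the two sequences interleave
    ([before_adj]).  Interleaving is transitive, hence holds throughout a
    monochromatic component.  The star edges at [p] have one colour, and
    interleaved vertices have different star colours ([star_colour_inj]), so a
    monochromatic component has at most [k] vertices.  Decreasing sequences are
    increasing ones for the reversed order.  Altogether, [H] has a 2-colouring
    with all monochromatic components of size at most [k]
    ([star_prod_two_colouring]).

    Triangulated grids of side [n] have no such colouring once [n] exceeds [k]:
    by a Hex argument some monochromatic component joins two opposite sides, and
    then it meets all [n] columns, or all [n] rows ([hex_component]).  Since the
    number of leaves needed depends on [H], the argument is run in a fixed grid
    of side [k.+1], which embeds in all larger ones. *)

(** * Ramsey's theorem for pairs *)

Lemma pigeonhole_count (K : finType) (T : Type) (g : T -> K) (s : seq T) n :
  #|K| * n < size s -> exists k, n < count (fun y => g y == k) s.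
Proof.
move=> lt_s; apply/existsP; apply: contraLR lt_s.
rewrite negb_exists -leqNgt => /forallP small.
rewrite -sum1_size (partition_big g predT) //= -sum_nat_const.
by apply: leq_sum => k _; rewrite sum1_count leqNgt small.
Qed.

(** The greedy half of Ramsey's theorem: a chosen element is stored with the
    colour of all the pairs that it forms with the later ones, so that a
    pigeonhole argument on the stored colours remains. *)
Lemma ramsey_end_homogeneous (K : finType) m : exists N,
  forall (T : eqType) (f : T -> T -> K) (s : seq T), N <= size s ->
  exists t : seq (T * K), [/\ size t = m, subseq (map fst t) s &
    pairwise (fun x y => f x.1 y.1 == x.2) t].
Proof.
elim: m => [|m [N IH]].
  by exists 0 => T f s _; exists [::]; rewrite sub0seq.
exists (#|K| * N).+2 => T f [|x s] //= lt_s.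
have [k /ltnW le_k] := pigeonhole_count (f x) lt_s.
rewrite -size_filter in le_k.
have [t [size_t sub_t pw_t]] := IH _ f _ le_k.
exists ((x, k) :: t); split; rewrite /= ?eqxx ?size_t //.
  exact: subseq_trans sub_t (filter_subseq _ _).
rewrite pw_t andbT; apply/allP => y ty.
have: y.1 \in filter (fun z => f x z == k) s.
  exact: mem_subseq sub_t _ (map_f _ ty).
by rewrite mem_filter => /andP[].
Qed.

Lemma ramsey (K : finType) m : exists N,
  forall (T : eqType) (f : T -> T -> K) (s : seq T), N <= size s ->
  exists (k : K) (t : seq T), [/\ m < size t, subseq t s &
    pairwise (fun x y => f x y == k) t].
Proof.
have [N ramN] := ramsey_end_homogeneous K (#|K| * m).+1.
exists N => T f s /(ramN _ f)[t [size_t sub_t pw_t]].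
have [k lt_k] : exists k, m < count (fun y : T * K => y.2 == k) t.
  by apply: pigeonhole_count; rewrite size_t.
exists k, (map fst (filter (fun y => y.2 == k) t)); split.
- by rewrite size_map size_filter.
- exact: subseq_trans (map_subseq _ (filter_subseq _ _)) sub_t.
rewrite pairwise_map.
have: pairwise (fun x y => f x.1 y.1 == x.2) (filter (fun y => y.2 == k) t).
  exact: subseq_pairwise (filter_subseq _ _) pw_t.
apply: (sub_in_pairwise (P := fun y => y.2 == k)); last exact: filter_all.
by move=> x y /eqP<- _ /=.
Qed.

(** * Stack layouts *)

Definition uncrossed (G : sgraph) (K : Type) (lt : rel G) (C : G -> G -> K) :=
  forall x x' y y', adj x x' -> adj y y' ->
    lt x y -> lt y x' -> lt x' y' -> C x x' <> C y y'.

Lemma uncrossed_flip (G : sgraph) (K : Type) (lt : rel G) (C : G -> G -> K) :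
  (forall x y, C x y = C y x) ->
  uncrossed lt C -> uncrossed (fun x y => lt y x) C.
Proof.
move=> Csym unc x x' y y' xx' yy' yx x'y y'x' eqC.
apply: (unc y' y x' x) => //; rewrite 1?adj_sym //.
by rewrite Csym -eqC Csym.
Qed.

Lemma strict_linear_order_flip (T : eqType) (lt : rel T) :
  strict_linear_order lt -> strict_linear_order (fun x y => lt y x).
Proof.
case=> irr tr tot; split=> // [y x z xy yz|x y xy]; first exact: tr yz xy.
by rewrite orbC tot.
Qed.

Lemma edge_in_edges (G : sgraph) (x y : G) :
  adj x y -> [set x; y] \in edges G.
Proof. by move=> xy; apply/imsetP; exists (x, y); rewrite ?inE. Qed.

(** Colouring pairs of vertices instead of edges, with [None] for the pairs that
    are not edges, avoids carrying adjacency proofs. *)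
Lemma stack_layout_uncrossed (G : sgraph) k : has_stack_layout G k ->
  exists (lt : rel G) (C : G -> G -> option 'I_k),
    [/\ strict_linear_order lt, (forall x y, C x y = C y x),
        (forall x y, adj x y -> C x y != None) & uncrossed lt C].
Proof.
case=> lt [colour [lin nocross]]; have [irr tr tot] := lin.
exists lt, (fun x y => omap colour (insub [set x; y])); split=> //.
- by move=> x y; rewrite setUC.
- by move=> x y /edge_in_edges xy; rewrite insubT.
move=> x x' y y' /edge_in_edges xx' /edge_in_edges yy' xy yx' x'y'.
rewrite !insubT /= => -[] /nocross; apply.
exists x, x', y, y'; split=> //; first exact: tr xy yx'.
  exact: tr yx' x'y'.
by rewrite xy yx' x'y'.
Qed.

Lemma has_stack_layout_sub (G H : sgraph) (f : G -> H) k k' :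
  injective f -> (forall x y, adj x y -> adj (f x) (f y)) -> k <= k' ->
  has_stack_layout H k -> has_stack_layout G k'.
Proof.
move=> inj_f adj_f le_k [lt [colour [[irr tr tot] nocross]]].
have edge_f (e : edge G) : f @: val e \in edges H.
  case: e => /= e /imsetP[[x y]]; rewrite inE /= => xy ->.
  by rewrite imsetU1 imset_set1 edge_in_edges // adj_f.
pose fe (e : edge G) : edge H := Sub (f @: val e) (edge_f e).
exists (fun x y => lt (f x) (f y)),
  (fun e => widen_ord le_k (colour (fe e))).
split; first split.
- by move=> x; apply: irr.
- by move=> y x z; apply: tr.
- by move=> x y; rewrite -(inj_eq inj_f); apply: tot.
move=> e e' /(congr1 val)/= /val_inj /nocross nc.
case=> x [x' [y [y' [ex ey xx' yy' cr]]]]; apply: nc.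
exists (f x), (f x'), (f y), (f y'); split=> //=.
  by rewrite ex imsetU1 imset_set1.
by rewrite ey imsetU1 imset_set1.
Qed.

Lemma stack_number_layout (G : sgraph) : has_stack_layout G (stack_number G).
Proof. by rewrite /stack_number; case: ex_minnP => k /boolp.asboolP. Qed.

(** * Homogeneous copies of a graph in a product with a star *)

(** The hypotheses are what Ramsey's theorem gives.  Thus [before p p] holds when
    the copies of [p] increase, and [before p q] together with [before q p]
    means that the copies of [p] and [q] interleave.  Four leaves are as many as
    [star_colour_lt] needs. *)
Section HomogeneousCopies.

Variables (a k : nat) (H : sgraph).
Let G := cart_prod (star a) H.
Variables (lt : rel G) (C : G -> G -> option 'I_k) (u : 'I_4 -> 'I_a).
Variables (before : rel H) (D : H -> H -> option 'I_k) (E : H -> option 'I_k).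

Let cp (i : 'I_4) (p : H) : G := (Some (u i), p).
Let rt (p : H) : G := (None, p).

Hypothesis lin : strict_linear_order lt.
Hypothesis C_sym : forall x y, C x y = C y x.
Hypothesis C_edge : forall x y, adj x y -> C x y != None.
Hypothesis unc : uncrossed lt C.
Hypothesis lt_cp : forall (i j : 'I_4) p q, i < j ->
  lt (cp i p) (cp j q) = before p q.
Hypothesis C_cp : forall i p q, C (cp i p) (cp i q) = D p q.
Hypothesis C_rt : forall i p, C (rt p) (cp i p) = E p.

Let i0 : 'I_4 := inord 0.
Let i1 : 'I_4 := inord 1.
Let i2 : 'I_4 := inord 2.
Let i3 : 'I_4 := inord 3.

Let i01 : i0 < i1. Proof. by rewrite !inordK. Qed.
Let i12 : i1 < i2. Proof. by rewrite !inordK. Qed.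
Let i23 : i2 < i3. Proof. by rewrite !inordK. Qed.
Let i02 : i0 < i2. Proof. by rewrite !inordK. Qed.

Lemma before_trans : transitive before.
Proof.
have [_ tr _] := lin.
move=> q p r pq qr; rewrite -(lt_cp _ _ i02).
by apply: (tr (cp i1 q)); rewrite lt_cp.
Qed.

(** If the copies of [q] do not interleave those of [p], they lie on one side
    of them; two sequences that increase side by side make the edges between
    corresponding terms cross, although these have one colour. *)
Lemma before_adj p q : adj p q -> before p p -> before q q -> before p q.
Proof.
have [_ _ tot] := lin.
move=> pq pp qq; apply/negPn/negP => npq.
have qp : lt (cp i1 q) (cp i0 p).
  have: cp i0 p != cp i1 q.
    by apply: contraTneq pq => -[_ ->]; rewrite adj_irrefl.
  by move=> /tot; rewrite lt_cp // (negPf npq).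
apply: (unc (x := cp i0 q) (x' := cp i0 p) (y := cp i1 q) (y' := cp i1 p)).
- by rewrite /= /cart_adj /= eqxx adj_sym pq.
- by rewrite /= /cart_adj /= eqxx adj_sym pq.
- by rewrite lt_cp.
- by [].
- by rewrite lt_cp.
by rewrite !C_cp.
Qed.

(** Interleaved copies contain the chain p0 < q1 < p2 < q3.  Wherever the roots
    [rt p] < [rt q] sit with respect to it, an edge at [rt p] crosses an edge
    at [rt q]. *)
Lemma star_colour_lt p q : before p q -> before q p -> E p = E q ->
  ~~ lt (rt p) (rt q).
Proof.
have [_ _ tot] := lin.
move=> pq qp eqE; apply/negP => ltr.
have adj_rt i r : adj (rt r) (cp i r) by rewrite /= /cart_adj /= eqxx.
have adj_cp i r : adj (cp i r) (rt r) by rewrite adj_sym.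
have lt01 : lt (cp i0 p) (cp i1 q) by rewrite lt_cp.
have lt12 : lt (cp i1 q) (cp i2 p) by rewrite lt_cp.
have lt23 : lt (cp i2 p) (cp i3 q) by rewrite lt_cp.
have eqC i j : C (cp i p) (rt p) = C (cp j q) (rt q).
  by rewrite ![C _ (rt _)]C_sym !C_rt.
have [q1p|] := boolP (lt (cp i1 q) (rt p)).
  exact: unc (adj_cp i0 p) (adj_cp i1 q) lt01 q1p ltr (eqC _ _).
move=> nq1p; have pq1 : lt (rt p) (cp i1 q).
  by have := tot (rt p) (cp i1 q) isT; rewrite (negPf nq1p) orbF.
have [p2q|] := boolP (lt (cp i2 p) (rt q)).
  apply: (unc (adj_rt i2 p) (adj_cp i1 q) pq1 lt12 p2q).
  by rewrite C_sym.
move=> np2q; have qp2 : lt (rt q) (cp i2 p).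
  by have := tot (rt q) (cp i2 p) isT; rewrite (negPf np2q) orbF.
apply: (unc (adj_rt i2 p) (adj_rt i3 q) ltr qp2 lt23).
by rewrite !C_rt.
Qed.

Lemma star_colour_inj p q : before p q -> before q p -> E p = E q -> p = q.
Proof.
have [_ _ tot] := lin.
move=> pq qp eqE; apply/eqP/negPn/negP => npq.
have: rt p != rt q by apply: contraNneq npq => -[->].
move=> /tot; apply/negP; rewrite negb_or.
by rewrite star_colour_lt // star_colour_lt.
Qed.

(** By [before_adj] and transitivity, all vertices of the component have copies
    that interleave those of [x], hence one another's; so their star colours
    are distinct. *)
Lemma increasing_component (e : rel H) x :
  (forall p q, e p q -> adj p q /\ before p p = before q q) ->
  before x x -> #|connect e x| <= k.
Proof.
move=> sub_e xx.
have inter y : connect e x y -> before x y && before y x.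
  move=> /connectP[s path_s ->].
  suff: [&& before x (last x s), before (last x s) x &
            before (last x s) (last x s)] by case/and3P=> -> ->.
  elim/last_ind: s path_s => [|s z IH]; first by rewrite /= xx.
  rewrite rcons_path last_rcons => /andP[/IH/and3P[xy yx yy]].
  case/sub_e=> yz eqyz; have zz := yy; rewrite eqyz in zz.
  have zy : adj z (last x s) by rewrite adj_sym.
  have bzy := before_adj zy zz yy; have byz := before_adj yz yy zz.
  by rewrite zz (before_trans xy byz) (before_trans bzy yx).
have injE : {in connect e x &, injective E}.
  move=> y z /inter/andP[xy yx] /inter/andP[xz zx].
  apply: star_colour_inj; first exact: before_trans yx xz.
  exact: before_trans zx xy.
rewrite -(card_in_imset injE).
have card_Some : #|[set~ (None : option 'I_k)]| = k.
  by rewrite cardsC1 card_option card_ord.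
rewrite -[X in _ <= X]card_Some.
apply: subset_leq_card; apply/subsetP => _ /imsetP[y _ ->].
by rewrite !inE -(C_rt i0) C_edge //= /cart_adj /= eqxx.
Qed.

End HomogeneousCopies.

(** The colour given to a pair of leaves for Ramsey's theorem records how the
    two copies of [H] interleave, and the stacks of the edges in and at the
    first copy.  The 2-colouring tells the vertices with increasing copies from
    those with decreasing ones. *)
Lemma star_prod_two_colouring (H : sgraph) k : exists a,
  has_stack_layout (cart_prod (star a) H) k ->
  exists red : pred H, forall x,
    #|connect (fun u v => adj u v && (red u == red v)) x| <= k.
Proof.
pose K := {ffun H * H -> bool * option 'I_k * option 'I_k} : finType.
have [a ram] := ramsey K 4; exists a => /stack_layout_uncrossed.
case=> lt [C [lin C_sym C_edge unc]].
pose f (i j : 'I_a) : K := [ffun pq =>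
  (lt (Some i, pq.1) (Some j, pq.2), C (Some i, pq.1) (Some i, pq.2),
   C (None, pq.1) (Some i, pq.1))].
have [|c [t [size_t sub_t pw_t]]] := ram _ f (enum 'I_a).
  by rewrite size_enum_ord.
have x0 : 'I_a by case: t size_t {sub_t pw_t}.
pose u (i : 'I_4) := nth x0 t i.
have lt5 (i : 'I_4) : i < 5 by apply: ltnW; rewrite ltnS.
have fu (i j : nat) : i < j -> j < 5 -> f (nth x0 t i) (nth x0 t j) = c.
  move=> ij j5; apply/eqP; move/(pairwiseP x0): pw_t; apply=> //.
    by rewrite inE; apply: leq_trans size_t; apply: ltn_trans ij _.
  by rewrite inE; apply: leq_trans size_t.
have uniq_t : uniq t by apply: subseq_uniq sub_t (enum_uniq _).
have neq_u (i j : 'I_4) : i < j -> u i != u j.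
  by move=> ij; rewrite nth_uniq ?ltn_eqF // (leq_trans _ size_t) // lt5.
pose before p q := (c (p, q)).1.1.
pose D p q := (c (p, q)).1.2.
pose E p := (c (p, p)).2.
have lt_u (i j : 'I_4) p q : i < j ->
    lt (Some (u i), p) (Some (u j), q) = before p q.
  by move=> ij; rewrite /before -(fu i j) // ffunE.
(* The fifth leaf only serves to read off the colours at the fourth one. *)
have C_u (i : 'I_4) p q : C (Some (u i), p) (Some (u i), q) = D p q.
  by rewrite /D -(fu i 4) ?ffunE.
have C_r (i : 'I_4) p : C (None, p) (Some (u i), p) = E p.
  by rewrite /E -(fu i 4) ?ffunE.
exists (fun p => before p p) => x.
have [xx|xx] := boolP (before x x).
  apply: (increasing_component lin C_sym C_edge unc lt_u C_u C_r) => //.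
  by move=> p q /andP[? /eqP].
(* Decreasing copies increase for the reversed order. *)
have lt_u' (i j : 'I_4) p q : i < j ->
    lt (Some (u j), q) (Some (u i), p) = ~~ before p q.
  move=> ij; rewrite -(lt_u _ _ _ _ ij).
  have [irr tr tot] := lin.
  have: (Some (u i), p) != (Some (u j), q) :> cart_prod (star a) H.
    by apply: contraNneq (neq_u _ _ ij) => -[->].
  move=> /tot; case: (boolP (lt _ _)) => //= ltij _.
  by apply: contraFF (irr (Some (u i), p)) => ltji; apply: tr ltij ltji.
apply: (increasing_component (strict_linear_order_flip lin) C_sym C_edge
  (uncrossed_flip C_sym unc) lt_u' C_u C_r) => // p q /andP[? /eqP->].
by [].
Qed.

(** * A Hex lemma for the triangulated grid *)

(** Green's formula modulo 2: if the sides of every unit square carry an even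
    sum, then so does the boundary of the grid. *)
Lemma discrete_green n (h v : nat -> nat -> bool) :
  (forall i j, i < n -> j < n ->
     h i j (+) h i j.+1 = v i j (+) v i.+1 j) ->
  \big[addb/false]_(i < n) h i 0 (+) \big[addb/false]_(i < n) h i n =
  \big[addb/false]_(j < n) v 0 j (+) \big[addb/false]_(j < n) v n j.
Proof.
move=> cell.
have strip j m : j < n -> m <= n ->
    \big[addb/false]_(i < m) h i j (+) \big[addb/false]_(i < m) h i j.+1 =
    v 0 j (+) v m j.
  move=> jn; elim: m => [|m IH] mn; first by rewrite !big_ord0 /= ?addbb.
  rewrite !big_ord_recr /= addbACA IH 1?ltnW // cell // addbA.
  by rewrite addbK.
suff rows m : m <= n ->
    \big[addb/false]_(i < n) h i 0 (+) \big[addb/false]_(i < n) h i m =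
    \big[addb/false]_(j < m) v 0 j (+) \big[addb/false]_(j < m) v n j.
  exact: rows.
elim: m => [|m IH] mn; first by rewrite !big_ord0 /= ?addbb.
rewrite !big_ord_recr /= addbACA -IH 1?ltnW // -(strip m n) //.
by rewrite addbA addbK.
Qed.

Lemma telescope_addb n (g : nat -> bool) :
  \big[addb/false]_(i < n) (g i (+) g i.+1) = g 0 (+) g n.
Proof.
elim: n => [|n IH]; first by rewrite big_ord0 addbb.
by rewrite big_ord_recr /= IH addbA addbK.
Qed.

(** Discrete intermediate values: [f] takes all the values of ['I_n.+1] on the
    component. *)
Lemma connect_spanning (T : finType) (e : rel T) n (f : T -> 'I_n.+1) x y :
  (forall u v, e u v -> f v <= (f u).+1) ->
  connect e x y -> f x = ord0 -> f y = ord_max -> n < #|connect e x|.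
Proof.
move=> step /connectP[s path_s ->] fx fy.
have hit m z : path e z s -> connect e x z -> f z <= m <= f (last z s) ->
    exists2 w, connect e x w & f w = m :> nat.
  elim: s z {path_s fy} => [|w s IH] z /=.
    by rewrite -eqn_leq => _ xz /eqP <-; exists z.
  case/andP=> zw ws xz /andP[zm ml].
  have [<-|neq] := eqVneq (f z : nat) m; first by exists z.
  apply: (IH w) => //; first exact: connect_trans xz (connect1 zw).
  by rewrite ml andbT (leq_trans (step _ _ zw)) // ltn_neqAle neq.
rewrite -[n.+1]card_ord -cardsT.
apply: leq_trans (leq_imset_card f (connect e x)).
apply: subset_leq_card; apply/subsetP => m _; apply/imsetP.
have [|w xw fw] := hit m x path_s (connect0 _ _).
  by rewrite fx fy leq0n -ltnS ltn_ord.
by exists w => //; apply: val_inj.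
Qed.

Lemma tgrid_adj_le n (u v : tgrid n) :
  adj u v -> v.1 <= u.1.+1 /\ v.2 <= u.2.+1.
Proof.
by case: u v => [u1 u2] [v1 v2]; rewrite /= /tgrid_adj /= !inE; lia.
Qed.

(** A component that joins opposite sides is large, by [connect_spanning].
    Suppose that red does not join the first column to the last one, nor blue
    the first row to the last one.  Label a vertex by its colour and by whether
    its component meets the first column (for red) or the first row (for blue).
    Some two vertices of a triangle share their colour, hence their label, so
    every triangle has evenly many sides joining a red vertex linked to the
    first column to a blue vertex linked to the first row.  By [discrete_green]
    the boundary of the grid has evenly many such sides too.  There are none on
    the last column and row.  On the first column all red vertices are linked
    to it, so the number of such sides there is, modulo 2, 1 if the corner
    (0, 0) is blue and 0 otherwise; symmetrically, it is 1 on the first row if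
    and only if this corner is red.  The total is odd, a contradiction. *)
Lemma hex_component n (red : pred (tgrid n.+1)) : exists x,
  n < #|connect (fun u v => adj u v && (red u == red v)) x|.
Proof.
set e := (X in connect X).
have sym_e : symmetric e by move=> u v; rewrite /e adj_sym eq_sym.
have csym := sym_connect_sym sym_e.
have [/existsP //|/existsPn small] := boolP [exists x, n < #|connect e x|].
exfalso.
have noLR x y : connect e x y -> x.1 = ord0 -> y.1 <> ord_max.
  move=> xy x0 yn; apply: (negP (small x)).
  apply: (connect_spanning (f := fst) _ xy) => // u v /andP[/tgrid_adj_le[]].
  by [].
have noTB x y : connect e x y -> x.2 = ord0 -> y.2 <> ord_max.
  move=> xy x0 yn; apply: (negP (small x)).
  apply: (connect_spanning (f := snd) _ xy) => // u v /andP[/tgrid_adj_le[]].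
  by [].
pose left u := [exists l, (l.1 == ord0) && connect e l u].
pose top u := [exists l, (l.2 == ord0) && connect e l u].
have side_e (P : pred (tgrid n.+1)) u v : e u v ->
    [exists l, P l && connect e l u] = [exists l, P l && connect e l v].
  move=> uv; apply: eq_existsb => l; congr andb.
  by rewrite ![connect e l _]csym (same_connect csym (connect1 uv)).
pose A u := red u && left u.
pose B u := ~~ red u && top u.
pose AB u v := A u && B v || B u && A v.
have triangle u v w : adj u v -> adj u w -> adj v w ->
    AB u v (+) AB u w (+) AB v w = false.
  move=> uv uw vw.
  have label x y : adj x y ->
      (red x == red y) ==> (left x == left y) && (top x == top y).
    move=> xy; apply/implyP => rxy.
    by rewrite /left /top !(side_e _ x y) ?eqxx // /e xy.
  move: (label _ _ uv) (label _ _ uw) (label _ _ vw); rewrite /AB /A /B.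
  by do 3!case: (red _); do 3!case: (left _); do 3!case: (top _).
pose pt i j : tgrid n.+1 := (inord i, inord j).
have adj_h i j : i < n -> j <= n -> adj (pt i j) (pt i.+1 j).
  by move=> lti ltj; rewrite /= /tgrid_adj /= !inordK ?inE; lia.
have adj_v i j : i <= n -> j < n -> adj (pt i j) (pt i j.+1).
  by move=> lti ltj; rewrite /= /tgrid_adj /= !inordK ?inE; lia.
have adj_d i j : i < n -> j < n -> adj (pt i j) (pt i.+1 j.+1).
  by move=> lti ltj; rewrite /= /tgrid_adj /= !inordK ?inE; lia.
have in0 : inord 0 = ord0 :> 'I_n.+1 by apply: val_inj; rewrite /= inordK.
have inn : inord n = ord_max :> 'I_n.+1 by apply: val_inj; rewrite /= inordK.
have left0 j : left (pt 0 j).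
  by apply/existsP; exists (pt 0 j); rewrite /= in0 eqxx connect0.
have top0 i : top (pt i 0).
  by apply/existsP; exists (pt i 0); rewrite /= in0 eqxx connect0.
have leftn j : left (pt n j) = false.
  by apply/existsP => -[l /andP[/eqP l0 /noLR]]; apply.
have topn i : top (pt i n) = false.
  by apply/existsP => -[l /andP[/eqP l0 /noTB]]; apply.
have := @discrete_green n (fun i j => AB (pt i j) (pt i.+1 j))
  (fun i j => AB (pt i j) (pt i j.+1)).
rewrite [X in _ (+) X = _]big1 => [|i _]; last first.
  by rewrite /AB /B !topn !andbF.
rewrite [X in _ = _ (+) X]big1 => [|j _]; last first.
  by rewrite /AB /A !leftn !andbF.
rewrite (eq_bigr (fun i : 'I_n => A (pt i 0) (+) A (pt i.+1 0)))
    => [|i _]; last first.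
  have := @side_e (fun l => l.1 == ord0) (pt i 0) (pt i.+1 0).
  rewrite -!/(left _) /e adj_h // /AB /A /B !top0.
  case: (red _) => /=; case: (red _) => /= [left_eq|_] //.
    by rewrite andbF left_eq ?addbb.
  by rewrite andbT orbF addbF.
rewrite [in RHS](eq_bigr (fun j : 'I_n => B (pt 0 j) (+) B (pt 0 j.+1)))
    => [|j _]; last first.
  have := @side_e (fun l => l.2 == ord0) (pt 0 j) (pt 0 j.+1).
  rewrite -!/(top _) /e adj_v // /AB /A /B !left0.
  case: (red _) => /=; case: (red _) => /= top_eq.
  - by [].
  - by rewrite orbF.
  - by rewrite andbT addbF.
  by rewrite andbF top_eq ?addbb.
rewrite (telescope_addb n (fun i => A (pt i 0))).
rewrite (telescope_addb n (fun j => B (pt 0 j))).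
rewrite /A /B left0 top0 leftn topn !andbF !andbT !addbF => green.
suff: red (pt 0 0) = ~~ red (pt 0 0) by case: (red _).
apply: green => i j lti ltj.
have := triangle _ _ _ (adj_h i j lti (ltnW ltj)) (adj_d i j lti ltj)
  (adj_v i.+1 j lti ltj).
have := triangle _ _ _ (adj_v i j (ltnW lti) ltj) (adj_d i j lti ltj)
  (adj_h i j.+1 lti ltj).
by do 5!case: (AB _ _).
Qed.

Theorem theorem1 : forall s : int,
  exists a0 n0 : nat,
    [/\ (0 < a0)%N, (0 < n0)%N &
        forall a n : nat, (a0 <= a)%N -> (n0 <= n)%N ->
          (s <= Posz (stack_number (cart_prod (star a) (tgrid n))))%R].
Proof.
move=> s; pose k := `|s|%N.
have [a0 bound] := star_prod_two_colouring (tgrid k.+1) k.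
exists a0.+1, k.+1; split=> // a n lea len.
have lea0 := ltnW lea.
suff: k < stack_number (cart_prod (star a) (tgrid n)) by rewrite /k; lia.
rewrite ltnNge; apply/negP => small.
have /bound[red] : has_stack_layout (cart_prod (star a0) (tgrid k.+1)) k.
  have inj_widen p q (lepq : p <= q) : injective (widen_ord lepq).
    by move=> x y /(congr1 val)/= /val_inj.
  pose f (x : cart_prod (star a0) (tgrid k.+1)) :
      cart_prod (star a) (tgrid n) :=
    (omap (widen_ord lea0) x.1, (widen_ord len x.2.1, widen_ord len x.2.2)).
  apply: (has_stack_layout_sub (f := f) _ _ small (stack_number_layout _)).
    move=> [x [x1 x2]] [y [y1 y2]] [] /(inj_omap (@inj_widen _ _ lea0))->.
    by move=> eq1 eq2; congr (_, (_, _)); apply: val_inj.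
  move=> [x [x1 x2]] [y [y1 y2]] /= /orP[]/andP[/eqP/= xy adj_xy].
    by apply/orP; left; rewrite /= xy eqxx.
  apply/orP; right; case: xy => -> ->; rewrite eqxx.
  by case: x y adj_xy => [x|] [y|].
have [x] := hex_component red.
by move=> + /(_ x); rewrite ltnNge => /negP.
Qed.
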